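(* Let $d=1$, $\gamma=0$ (Haar case) and $\Delta\ell\ge 0$. Then, for each velocity of the scheme, with dimensionless velocity $c\in\mathbb{Z}$, the flattened weights $(C_{\Delta\ell,m})_{m=-2}^{2}$ of the adaptive multiresolution stream phase read $$C_{\Delta\ell,0}=-|c|,\qquad C_{\Delta\ell,-c/|c|}=|c|,$$ and those not listed are equal to zero (for $c=0$ all weights are zero). Therefore, the adaptive stream phase matches that of the reference scheme up to order $s=1$. This also writes $$\sum_{m=-2}^{2}C_{\Delta\ell,m}=0,\qquad \sum_{m=-2}^{2}m\,C_{\Delta\ell,m}=-c .$$
   Context: Setting ($d=1$). Cells of level $\ell$ are indexed by $k\in\mathbb{Z}$; $\overline{L}$ is the finest level and $\Delta\ell=\overline{L}-\ell\ge 0$. The cell $(\ell,k)$ has the two children $(\ell+1,2k)$ and $(\ell+1,2k+1)$. Each distribution function of the lattice Boltzmann scheme moves with a dimensionless velocity $c\in\mathbb{Z}$, and one assumes $|c|\le 2$ for all velocities of the scheme. Let $(f_k)_{k\in\mathbb{Z}}$ be the post-collision cell averages of one distribution function at level $\ell$ (the mesh is locally uniform at level $\ell$). Prediction and reconstruction for $\gamma=0$ ($\gamma$ is the size of the prediction stencil): the predicted value on a child is the value of its father, $\hat g_{2k+\delta}=g_k$ for $\delta=0,1$. The reconstruction $(\hat{\hat f}_{\overline k})_{\overline k\in\mathbb{Z}}$ on the finest level $\overline{L}$ is obtained from $(f_k)_k$ by applying the prediction operator recursively $\Delta\ell$ times (if $\Delta\ell=0$ it is $f$ itself). Multiresolution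 stream phase: with $\mathcal{B}_k=\{2^{\Delta\ell}k+\delta:\ \delta=0,\dots,2^{\Delta\ell}-1\}$, $\mathcal{E}_k=(\mathcal{B}_k-c)\setminus\mathcal{B}_k$, $\mathcal{A}_k=\mathcal{B}_k\setminus(\mathcal{B}_k-c)$, the updated average on cell $(\ell,k)$ is $$f_k+\frac{1}{2^{\Delta\ell}}\Big(\sum_{\overline k\in\mathcal{E}_k}\hat{\hat f}_{\overline k}-\sum_{\overline k\in\mathcal{A}_k}\hat{\hat f}_{\overline k}\Big).$$ Flattened weights: the real numbers $(C_{\Delta\ell,m})_{m=-2}^{2}$ (depending on $c$) such that this updated average equals $$f_k+\frac{1}{2^{\Delta\ell}}\sum_{m=-2}^{2}C_{\Delta\ell,m}\,f_{k+m}.$$ Match: the adaptive stream phase matches that of the reference scheme (the scheme on the uniform mesh at the finest level $\overline L$) at order $s\ge 1$ whenever $\sum_{m=-2}^{2}C_{\Delta\ell,m}=0$ and $\sum_{m=-2}^{2}m^pC_{\Delta\ell,m}=\dfrac{(-c)^p}{2^{\Delta\ell(p-1)}}$ for $p=1,\dots,s$, for every $\Delta\ell\ge 0$ and every velocity $c$ of the scheme.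
   Formalization: The weight formula is stated for |c| ≤ 2^{Δℓ}; in the only other case, Δℓ=0 and |c|=2, the printed formula fails and the weights are shown to be C_{0,0}=-1, C_{0,-c}=1. The order-1 match and both sums are kept in all cases. *)

(* Defs.v *)
From HB Require Import structures.
From mathcomp Require Import all_boot all_order all_algebra.
From mathcomp Require Import finmap reals.

Set Implicit Arguments.
Unset Strict Implicit.
Unset Printing Implicit Defensive.
Import Order.TTheory GRing.Theory Num.Theory.
Local Open Scope ring_scope.

Section HaarStream.
Variable R : realType.
Implicit Types (c k : int) (dl : nat) (f g : int -> R) (C : int -> R).

(* [j %/ 2] rounds towards -oo, so it is the father of [j] for negative [j]
   too: see [predict_child]. *)
Definition predict g : int -> R := fun j => g (j %/ 2)%Z.

Lemma predict_child g k (d : nat) : (d < 2)%N -> predict g (2 * k + d%:Z) = g k.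
Proof.
move=> d2; rewrite /predict divzDl ?dvdz_mulr // mulKz //.
by rewrite divz_small ?addr0 //= ltz_nat.
Qed.

(* [dl] is the distance to the finest level. *)
Definition reconstruct dl f : int -> R := iter dl predict f.

Definition block dl k : {fset int} :=
  [fset ((2 ^ dl)%N%:Z * k + d%:Z)%R | d in iota 0 (2 ^ dl)]%fset.

Definition shifted_block dl c k : {fset int} := [fset (b - c)%R | b in block dl k]%fset.

Definition inflow dl c k : {fset int} := (shifted_block dl c k `\` block dl k)%fset.
Definition outflow dl c k : {fset int} := (block dl k `\` shifted_block dl c k)%fset.

Definition stream dl c f k : R :=
  f k + (2 ^+ dl)^-1 * (\sum_(j <- inflow dl c k) reconstruct dl f j
                        - \sum_(j <- outflow dl c k) reconstruct dl f j).

Definition stencil : seq int := [:: -2; -1; 0; 1; 2].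

(* Weights are functions on [int] of which only the values on [stencil] are
   meaningful. *)
Definition flattened_weights dl c C : Prop :=
  forall f k,
    stream dl c f k = f k + (2 ^+ dl)^-1 * \sum_(m <- stencil) C m * f (k + m).

Definition matches (velocities : seq int) (s : nat) : Prop :=
  forall dl c, c \in velocities ->
  exists C : int -> R,
    [/\ flattened_weights dl c C,
        \sum_(m <- stencil) C m = 0 &
        forall p : nat, (1 <= p <= s)%N ->
          \sum_(m <- stencil) m%:~R ^+ p * C m
            = (- c%:~R) ^+ p / 2 ^+ (dl * p.-1)].

(* [sgz c] is c / |c|, and 0 for c = 0, in which case all weights vanish. *)
Definition haar_weight c : int -> R := fun m =>
  if m == 0 then - `|c|%:~R else if m == - sgz c then `|c|%:~R else 0.

(* The weights of f_k |-> f_(k - c) for c <> 0, i.e. of the stream phase at the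
   finest level (dl = 0); they differ from [haar_weight c] when |c| >= 2. *)
Definition shift_weight c : int -> R := fun m =>
  if m == 0 then -1 else if m == - c then 1 else 0.

End HaarStream.

(* Main.v *)
Require Import Defs.
From HB Require Import structures.
From mathcomp Require Import all_boot all_order all_algebra.
From mathcomp Require Import finmap reals.
From mathcomp Require Import zify ring.

Set Implicit Arguments.
Unset Strict Implicit.
Unset Printing Implicit Defensive.
Import Order.TTheory GRing.Theory Num.Theory.
Local Open Scope ring_scope.

(** In the Haar case the reconstruction is piecewise constant: the value on the
    fine cell [j] is that of the coarse cell [j %/ 2 ^ dl] containing it
    ([reconstructE]).  Cells lying both in a block and in its translate cancel in
    inflow minus outflow, so the stream phase adds to [f k] the mean, over the
    fine cells [j] of the block of [k], of the jump of the reconstruction from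
    [j] to [j - c] ([streamE]).

    When [`|c| <= 2 ^ dl], moving upstream by [c] sends exactly [`|c|] of the
    fine cells of the block into the neighbouring block [k - sgz c] and leaves
    the others inside, so the jumps add up to
    [`|c| * (f (k - sgz c) - f k)] ([sum_upstream_jumps]).  When [`|c| = 2],
    the bound fails only for [dl = 0], where the stream phase is the translation
    [f k |-> f (k - c)].

    In all cases the flattened weights thus move an amount [a] from the centre of
    the stencil to one point [o], with [a * o = - c] ([stream_transfer]).  Such
    weights have zero sum and first moment [a * o], which is the matching
    condition of order 1.  Testing against indicator functions of single cells
    shows that flattened weights are determined on the stencil
    ([flattened_weights_unique]). *)

Lemma sum_fsetD_sub (T : choiceType) (V : zmodType) (A B : {fset T})
    (F : T -> V) :
  \sum_(j <- (A `\` B)%fset) F j - \sum_(j <- (B `\` A)%fset) F j =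
  \sum_(j <- A) F j - \sum_(j <- B) F j.
Proof.
have split_sum (X Y : {fset T}) : \sum_(j <- X) F j =
    \sum_(j <- (X `&` Y)%fset) F j + \sum_(j <- (X `\` Y)%fset) F j.
  rewrite (big_fsetID _ (mem Y)) /=; congr (_ + _); apply: eq_fbigl => j;
    by rewrite !inE //= andbC.
rewrite (split_sum A B) (split_sum B A) fsetIC.
by rewrite opprD addrACA subrr add0r.
Qed.

Lemma sum_block (V : nmodType) (dl : nat) (k : int) (F : int -> V) :
  \sum_(j <- block dl k) F j =
  \sum_(0 <= d < 2 ^ dl) F ((2 ^ dl)%N%:Z * k + d%:Z).
Proof.
rewrite /block big_imfset /=; last by move=> d d' _ _ /addrI [].
by rewrite undup_id ?iota_uniq // /index_iota subn0.
Qed.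

Lemma sum_shifted_block (V : nmodType) (dl : nat) (c k : int) (F : int -> V) :
  \sum_(j <- shifted_block dl c k) F j = \sum_(j <- block dl k) F (j - c).
Proof. by rewrite /shifted_block big_imfset //= => b b' _ _ /addIr. Qed.

Lemma reconstructE (R : realType) (dl : nat) (f : int -> R) (j : int) :
  reconstruct dl f j = f (j %/ (2 ^ dl)%N%:Z)%Z.
Proof.
elim: dl j => [|dl IH] j; first by rewrite /reconstruct /= divz1.
by apply: etrans (IH (j %/ 2)%Z) _; rewrite -divzMA_ge0 // expnS PoszM.
Qed.

(** The quotient [n * k + d] by [n] locates the block of a fine cell whose
    offset [d] may leave the range [0 <= d < n]. *)
Lemma divz_block (n : nat) (k d : int) : (0 < n)%N ->
  ((n%:Z * k + d) %/ n%:Z)%Z = k + (d %/ n%:Z)%Z.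
Proof. by move=> n_gt0; rewrite mulrC divzMDl // -lt0n. Qed.

Lemma streamE (R : realType) (dl : nat) (c : int) (f : int -> R) (k : int) :
  stream dl c f k = f k + (2 ^+ dl)^-1 *
    \sum_(0 <= d < 2 ^ dl) (f (k + ((d%:Z - c) %/ (2 ^ dl)%N%:Z)%Z) - f k).
Proof.
rewrite /stream /inflow /outflow sum_fsetD_sub sum_shifted_block !sum_block.
rewrite -sumrB; congr (_ + _ * _); apply: eq_big_nat => d /andP[_ d_lt].
rewrite !reconstructE -addrA !divz_block ?expn_gt0 //.
by rewrite divz_nat divn_small // addr0.
Qed.

(** Of the [n] cells of a block, the [`|c|] ones nearest to the upstream end
    (the first ones for [c >= 0], the last ones for [c < 0]) leave the block
    when moved by [- c]. *)
Lemma sum_upstream_jumps (R : pzRingType) (n : nat) (c : int) (f : int -> R)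
    (k : int) : `|c| <= n%:Z ->
  \sum_(0 <= d < n) (f (k + ((d%:Z - c) %/ n%:Z)%Z) - f k) =
  `|c|%:~R * (f (k - sgz c) - f k).
Proof.
have quotE (q : int) (d : nat) : q * n%:Z <= d%:Z - c < (q + 1) * n%:Z ->
    ((d%:Z - c) %/ n%:Z)%Z = q.
  move=> bounds; have n_neq0 : n%:Z != 0.
    by apply: contraTneq bounds => ->; rewrite !mulr0; lia.
  have -> : d%:Z - c = q * n%:Z + (d%:Z - c - q * n%:Z) by ring.
  by rewrite divzMDl // divz_small ?addr0 //; nia.
have const_sum (a b : nat) (q : int) :
    (forall d, (a <= d < b)%N -> q * n%:Z <= d%:Z - c < (q + 1) * n%:Z) ->
    \sum_(a <= d < b) (f (k + ((d%:Z - c) %/ n%:Z)%Z) - f k) =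
    (b - a)%:R * (f (k + q) - f k).
  move=> bounds; rewrite (eq_big_nat _ _ (F2 := fun=> f (k + q) - f k)).
    by rewrite sumr_const_nat mulr_natl.
  by move=> d /bounds/quotE ->.
case: (ltrgtP c 0) => [c_lt0|c_gt0|c0] c_le.
- rewrite (@big_cat_nat _ _ _ (n - `|c|)) ?leq_subr //=.
  rewrite (const_sum _ _ 0); last by move=> d; lia.
  rewrite (const_sum _ _ 1); last by move=> d; lia.
  rewrite addr0 subrr mulr0 add0r (ltr0_sgz c_lt0) opprK.
  by congr (_ * _); rewrite -pmulrn; congr _%:R; lia.
- rewrite (@big_cat_nat _ _ _ `|c|) //=.
  rewrite (const_sum _ _ (-1)); last by move=> d; lia.
  rewrite (const_sum _ _ 0); last by move=> d; lia.
  rewrite addr0 subrr mulr0 addr0 (gtr0_sgz c_gt0).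
  by congr (_ * _); rewrite -pmulrn; congr _%:R; lia.
- rewrite (const_sum _ _ 0); last by move=> d; lia.
  by rewrite c0 normr0 addr0 subrr mulr0 mul0r.
Qed.

(** Common form of [haar_weight c] (with [a := `|c|] and [o := - sgz c]) and
    [shift_weight c] (with [a := 1] and [o := - c]), both by conversion. *)
Definition transfer_weight (R : pzRingType) (a : R) (o : int) : int -> R :=
  fun m => if m == 0 then - a else if m == o then a else 0.

Lemma sum_transfer_weight (R : comNzRingType) (a : R) (o : int) (g : int -> R) :
  o \in stencil -> (o = 0 -> a = 0) ->
  \sum_(m <- stencil) transfer_weight a o m * g m = a * (g o - g 0).
Proof.
rewrite !inE /stencil !big_cons big_nil /transfer_weight.
by case/or4P=> [/eqP->|/eqP->|/eqP->|/orP[]/eqP->] a0 /=;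
  rewrite ?(a0 erefl); ring.
Qed.

Lemma small_int_stencil (c : int) : `|c| <= 2 -> c \in stencil.
Proof. by move=> c_le2; rewrite !inE; lia. Qed.

Lemma oppr_sgz_stencil (c : int) : - sgz c \in stencil.
Proof. by case: sgzP. Qed.

Lemma oppr_sgz_eq0 (R : pzRingType) (c : int) :
  - sgz c = 0 -> `|c|%:~R = 0 :> R.
Proof. by move/eqP; rewrite oppr_eq0 sgz_eq0 => /eqP->; rewrite normr0. Qed.

Lemma haar_flattened_weights (R : realType) (dl : nat) (c : int) :
  `|c| <= (2 ^ dl)%N%:Z -> flattened_weights dl c (haar_weight R c).
Proof.
move=> c_le f k; rewrite streamE sum_upstream_jumps //.
rewrite (sum_transfer_weight (a := `|c|%:~R) (o := - sgz c) (fun m => f (k + m))).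
- by rewrite addr0.
- exact: oppr_sgz_stencil.
- exact: oppr_sgz_eq0.
Qed.

Lemma shift_flattened_weights (R : realType) (c : int) :
  `|c| <= 2 -> c != 0 -> flattened_weights 0 c (shift_weight R c).
Proof.
move=> c_le2 c_neq0 f k; rewrite streamE expn0 big_nat1 divz1 sub0r.
rewrite (sum_transfer_weight (a := 1) (o := - c) (fun m => f (k + m))).
- by rewrite addr0 mul1r.
- by apply: small_int_stencil; rewrite normrN.
- by move/eqP; rewrite oppr_eq0 (negPf c_neq0).
Qed.

(** The stream phase reads off the weight at [m] when [f] is the indicator of
    the cell [m] and the updated cell is [0]. *)
Lemma flattened_weights_unique (R : realType) (dl : nat) (c : int)
    (W : int -> R) : flattened_weights dl c W ->
  forall C : int -> R, flattened_weights dl c C <->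
    (forall m : int, m \in stencil -> C m = W m).
Proof.
move=> flatW C; split=> [flatC m m_in|eqCW f k]; last first.
  rewrite flatW; congr (_ + _ * _).
  by apply: eq_big_seq => m m_in; rewrite eqCW.
pose f (j : int) : R := (j == m)%:R.
have pick_m (V : int -> R) : \sum_(j <- stencil) V j * f (0 + j) = V m.
  rewrite (bigD1_seq m) //= add0r /f eqxx mulr1 big1 ?addr0 // => j.
  by rewrite add0r => /negPf->; rewrite mulr0.
have := flatC f 0; rewrite flatW !pick_m => /addrI /mulfI -> //.
by rewrite invr_eq0 expf_neq0 // pnatr_eq0.
Qed.

Lemma stream_transfer (R : realType) (dl : nat) (c : int) : `|c| <= 2 ->
  exists (a : R) (o : int),
    [/\ flattened_weights dl c (transfer_weight a o), o \in stencil,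
        o = 0 -> a = 0 & a * o%:~R = - c%:~R].
Proof.
move=> c_le2; have [c_le|c_gt] := lerP `|c| (2 ^ dl)%N%:Z.
  exists `|c|%:~R, (- sgz c); split.
  - exact: haar_flattened_weights.
  - exact: oppr_sgz_stencil.
  - exact: oppr_sgz_eq0.
  - by rewrite -intrM mulrN mulrC -intEsg rmorphN.
have dl0 : dl = 0%N.
  by case: dl c_gt => // dl; rewrite expnS; have := expn_gt0 2 dl; lia.
have c_neq0 : c != 0 by apply: contraTneq c_gt => ->; rewrite dl0.
exists 1, (- c); split.
- by rewrite dl0; exact: shift_flattened_weights.
- by apply: small_int_stencil; rewrite normrN.
- by move/eqP; rewrite oppr_eq0 (negPf c_neq0).
- by rewrite mul1r rmorphN.
Qed.

Lemma flattened_weights_moments (R : realType) (dl : nat) (c : int)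
    (C : int -> R) : `|c| <= 2 -> flattened_weights dl c C ->
  \sum_(m <- stencil) C m = 0 /\ \sum_(m <- stencil) m%:~R * C m = - c%:~R.
Proof.
move=> c_le2; have [a [o [flatW o_in o0 ao]]] := stream_transfer R dl c_le2.
move/(flattened_weights_unique flatW) => CE.
rewrite (eq_big_seq (fun m => transfer_weight a o m * 1)); last first.
  by move=> m /CE->; rewrite mulr1.
rewrite (eq_big_seq (F1 := fun m => m%:~R * C m)
  (fun m => transfer_weight a o m * m%:~R)); last first.
  by move=> m /CE->; rewrite mulrC.
by rewrite sum_transfer_weight // sum_transfer_weight // subrr mulr0 subr0.
Qed.

Theorem proposition5p3 (R : realType) (velocities : seq int)
    (velocities_le2 : forall c : int, c \in velocities -> `|c| <= 2) :
  [/\ forall (dl : nat) (c : int), c \in velocities ->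
        `|c| <= (2 ^ dl)%N%:Z ->
        forall C : int -> R, flattened_weights dl c C <->
          (forall m : int, m \in stencil -> C m = haar_weight R c m),
      (* the only remaining case: dl = 0 and |c| = 2 *)
      forall c : int, c \in velocities -> `|c| = 2 ->
        forall C : int -> R, flattened_weights 0 c C <->
          (forall m : int, m \in stencil -> C m = shift_weight R c m),
      matches R velocities 1 &
      forall (dl : nat) (c : int), c \in velocities ->
        forall C : int -> R, flattened_weights dl c C ->
          \sum_(m <- stencil) C m = 0 /\
          \sum_(m <- stencil) m%:~R * C m = - c%:~R].
Proof.
split.
- move=> dl c _ c_le; exact/flattened_weights_unique/haar_flattened_weights.
- move=> c _ c2; apply/flattened_weights_unique/shift_flattened_weights.
    by rewrite c2.
  by rewrite -normr_eq0 c2.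
- move=> dl c /velocities_le2 c_le2.
  have [a [o [flatW _ _ _]]] := stream_transfer R dl c_le2.
  have [sum0 sum1] := flattened_weights_moments c_le2 flatW.
  exists (transfer_weight a o); split=> // -[|[|p]] // _.
  by rewrite muln0 divr1 -sum1.
- by move=> dl c /velocities_le2 c_le2 C; exact: flattened_weights_moments.
Qed.
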